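(* Let $t,a$ be real numbers with $-\frac32<t<-1$ and $a<\frac56$. Then $${}_2F_1\!\left(\tfrac43-a,\,2-2a;\,3-3a;\ -\frac{t(2t+3)}{t+2}\right)=C\cdot{}_2F_1\!\left(\tfrac56,\,\tfrac32-a;\,\tfrac53-a;\ -\frac{(2t+3)^3}{t^3(t+2)}\right),$$ where $$C=2^{2a-2}\,3^{\frac52-3a}\,(-t)^{3a-\frac92}\,(t+2)^{\frac12-a}\,(t+3)^2.$$
   Context: ${}_2F_1(A,B;c;z)=\sum_{n\ge0}\frac{(A)_n(B)_n}{(c)_n}\frac{z^n}{n!}$ for $|z|<1$, with $(q)_n=\Gamma(q+n)/\Gamma(q)$, is the Gauss hypergeometric function, analytically continued to $z\in\mathbb{C}\setminus[1,\infty)$; for $\mathrm{Re}(c)>\mathrm{Re}(A)>0$ the continuation is given by $${}_2F_1(A,B;c;z)=\frac{\Gamma(c)}{\Gamma(A)\Gamma(c-A)}\int_0^1u^{A-1}(1-u)^{c-A-1}(1-zu)^{-B}\,du.$$ *)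

(* Defs.v *)
From Stdlib Require Import Reals Lra Psatz Factorial.
From Coquelicot Require Import Coquelicot.
Open Scope R_scope.

(* The Pochhammer symbol (q)_n = q (q+1) ... (q+n-1). *)
Fixpoint pochhammer (q : R) (n : nat) : R :=
  match n with
  | O => 1
  | S m => pochhammer q m * (q + INR m)
  end.

(* (q)_n = Gamma(q+n)/Gamma(q): of Gamma, this uses only the functional
   equation at q, q+1, q+2, ... and Gamma(q) <> 0. *)
Lemma pochhammer_Gamma (Gamma : R -> R) (q : R) (n : nat) :
  (forall m : nat, Gamma (q + INR m + 1) = (q + INR m) * Gamma (q + INR m)) ->
  Gamma q <> 0 ->
  pochhammer q n = Gamma (q + INR n) / Gamma q.
Proof.
intros HG Hq; induction n as [|n IH].
- simpl; rewrite Rplus_0_r; field; exact Hq.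
- rewrite S_INR; simpl pochhammer; rewrite IH.
  replace (q + (INR n + 1)) with (q + INR n + 1) by ring.
  rewrite HG; field; exact Hq.
Qed.

(* The Gauss function 2F1(A,B;c;z) for real parameters and real |z| < 1, as the
   sum of its series; [PSeries] is total, and its value is meaningful when
   |z| < 1 and c is not a nonpositive integer.  No analytic continuation is
   needed at the arguments below: they lie in (0,1). *)
Definition hyp2F1 (A B c z : R) : R :=
  PSeries (fun n => pochhammer A n * pochhammer B n / pochhammer c n
                    / INR (fact n)) z.

Lemma lhs_argument_bounds (t : R) :
  -3/2 < t < -1 -> 0 < - (t * (2 * t + 3) / (t + 2)) < 1.
Proof.
intros Ht.
replace (- (t * (2 * t + 3) / (t + 2))) with ((- t * (2 * t + 3)) / (t + 2))
  by (field; lra).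
split.
- apply Rdiv_lt_0_compat; nra.
- apply Rlt_div_l; nra.
Qed.

Lemma rhs_argument_bounds (t : R) :
  -3/2 < t < -1 -> 0 < - ((2 * t + 3) ^ 3 / (t ^ 3 * (t + 2))) < 1.
Proof.
intros Ht.
assert (Hd : 0 < (- t) ^ 3 * (t + 2))
  by (apply Rmult_lt_0_compat; [apply pow_lt|]; lra).
replace (- ((2 * t + 3) ^ 3 / (t ^ 3 * (t + 2))))
  with ((2 * t + 3) ^ 3 / ((- t) ^ 3 * (t + 2))) by (field; lra).
split.
- apply Rdiv_lt_0_compat; [apply pow_lt; lra | exact Hd].
- apply Rlt_div_l; [exact Hd|].
  assert (H3 : 0 < (t + 3) ^ 3) by (apply pow_lt; lra).
  assert (H : 0 < (- 1 - t) * (t + 3) ^ 3)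
    by (apply Rmult_lt_0_compat; [lra | exact H3]).
  lra.
Qed.

(* Main.v *)
Require Import Defs.
From Stdlib Require Import Reals Lra Psatz Factorial.
From Coquelicot Require Import Coquelicot.
Open Scope R_scope.

(** Both sides, as functions of [t] on the interval from [-3/2] to [-1], solve
    one and the same second-order linear equation [w'' + P w' + Q w = 0], with
    [P] and [Q] rational in [t]: it is the pullback of the hypergeometric
    equation along the left-hand argument, and also along the right-hand one
    after multiplication by the prefactor [C].  This is an instance of
    [hyp2F1_pullback_solves], whose hypotheses reduce to identities between
    rational functions ([lhs_solves], [rhs_solves]).

    Both arguments vanish at [t = -3/2], where [C = 1], so both sides tend to
    [1] there.  The point is singular for the equation, with exponents [0] and
    [3a - 2], so the common value [1] does not by itself identify the two
    solutions; but both have a continuous derivative up to that point.  Their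
    Wronskian is therefore bounded near [-3/2], while by Abel's identity it is
    a constant over an integrating factor that vanishes like [(2t+3)^(3-3a)].
    Hence the Wronskian is zero, and the quotient of the two sides is
    constant, with limit [1] ([solves_ode_unique]).  The quotient makes sense because the
    left-hand series, all of whose parameters are positive, has positive
    coefficients. *)

(** * The hypergeometric series and its differential equation *)

Definition hyp_coef (A B c : R) (n : nat) : R :=
  pochhammer A n * pochhammer B n / pochhammer c n / INR (fact n).

Lemma pochhammer_pos (q : R) (n : nat) : 0 < q -> 0 < pochhammer q n.
Proof.
intros Hq; induction n as [|n IH]; simpl; [lra|].
apply Rmult_lt_0_compat; [exact IH|].
generalize (pos_INR n); lra.
Qed.

Lemma hyp_coef_pos (A B c : R) (n : nat) :
  0 < A -> 0 < B -> 0 < c -> 0 < hyp_coef A B c n.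
Proof.
intros HA HB Hc; unfold hyp_coef.
repeat first [apply Rdiv_lt_0_compat | apply Rmult_lt_0_compat];
  try (apply pochhammer_pos; assumption).
apply INR_fact_lt_0.
Qed.

Lemma hyp_coef_S (A B c : R) (n : nat) :
  0 < c ->
  hyp_coef A B c (S n)
  = hyp_coef A B c n * ((A + INR n) * (B + INR n) / ((c + INR n) * (INR n + 1))).
Proof.
intros Hc; unfold hyp_coef.
rewrite fact_simpl, mult_INR, S_INR; simpl pochhammer.
generalize (pochhammer_pos c n Hc) (INR_fact_lt_0 n) (pos_INR n); intros.
field; repeat split; lra.
Qed.

(** The factors of the ratio of consecutive coefficients, for the ratio test. *)
Lemma is_lim_seq_shift_ratio (x y : R) :
  is_lim_seq (fun n => (x + INR n) / (y + INR n)) 1.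
Proof.
assert (Hinf : is_lim_seq (fun n => y + INR n) p_infty).
{ eapply is_lim_seq_plus;
    [apply is_lim_seq_const | apply is_lim_seq_INR | reflexivity]. }
assert (Hinv : is_lim_seq (fun n => / (y + INR n)) 0).
{ apply (is_lim_seq_inv _ p_infty); [exact Hinf | discriminate]. }
apply is_lim_seq_ext_loc with (fun n => 1 + (x - y) * / (y + INR n)).
{ destruct (nfloor_ex (Rabs y) (Rabs_pos y)) as [N HN].
  exists (S N); intros n Hn.
  apply le_INR in Hn; rewrite S_INR in Hn.
  assert (0 < y + INR n)
    by (generalize (Rabs_maj2 y); lra).
  field; lra. }
replace (Finite 1) with (Finite (1 + (x - y) * 0)) by (f_equal; ring).
apply is_lim_seq_plus'; [apply is_lim_seq_const|].
now apply (is_lim_seq_scal_l _ (x - y) 0).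
Qed.

Lemma CV_radius_hyp_coef (A B c : R) :
  0 < A -> 0 < B -> 0 < c -> CV_radius (hyp_coef A B c) = 1.
Proof.
intros HA HB Hc.
rewrite (CV_radius_finite_DAlembert _ 1).
- f_equal; field.
- intros n; apply Rgt_not_eq, hyp_coef_pos; assumption.
- lra.
- apply is_lim_seq_ext with
    (fun n => (A + INR n) / (c + INR n) * ((B + INR n) / (1 + INR n))).
  + intros n; rewrite hyp_coef_S by exact Hc.
    generalize (hyp_coef_pos A B c n HA HB Hc) (pos_INR n).
    generalize (hyp_coef A B c n); intros.
    rewrite Rabs_pos_eq.
    * field; repeat split; lra.
    * apply Rlt_le.
      repeat first [apply Rdiv_lt_0_compat | apply Rmult_lt_0_compat]; lra.
  + replace (Finite 1) with (Finite (1 * 1)) by (f_equal; ring).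
    apply is_lim_seq_mult'; apply is_lim_seq_shift_ratio.
Qed.

Definition hyp2F1_d1 (A B c z : R) : R :=
  PSeries (PS_derive (hyp_coef A B c)) z.

Definition hyp2F1_d2 (A B c z : R) : R :=
  PSeries (PS_derive (PS_derive (hyp_coef A B c))) z.

Lemma is_derive_hyp2F1 (A B c z : R) :
  0 < A -> 0 < B -> 0 < c -> Rabs z < 1 ->
  is_derive (hyp2F1 A B c) z (hyp2F1_d1 A B c z).
Proof.
intros HA HB Hc Hz; apply (is_derive_PSeries (hyp_coef A B c)).
rewrite CV_radius_hyp_coef; assumption.
Qed.

Lemma is_derive_hyp2F1_d1 (A B c z : R) :
  0 < A -> 0 < B -> 0 < c -> Rabs z < 1 ->
  is_derive (hyp2F1_d1 A B c) z (hyp2F1_d2 A B c z).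
Proof.
intros HA HB Hc Hz; apply (is_derive_PSeries (PS_derive (hyp_coef A B c))).
rewrite CV_radius_derive, CV_radius_hyp_coef; assumption.
Qed.

(** The coefficient of [z^n] on the left is
    [(n+1)(c+n) a_(n+1) - (A+n)(B+n) a_n], which is zero because
    [a_(n+1) / a_n] is the ratio of those two factors. *)
Lemma hyp2F1_ode (A B c z : R) :
  0 < A -> 0 < B -> 0 < c -> Rabs z < 1 ->
  z * (1 - z) * hyp2F1_d2 A B c z
  + (c - (A + B + 1) * z) * hyp2F1_d1 A B c z - A * B * hyp2F1 A B c z = 0.
Proof.
intros HA HB Hc Hz.
set (a := hyp_coef A B c).
assert (Hr : CV_radius a = 1) by (apply CV_radius_hyp_coef; assumption).
assert (H0 : is_pseries a z (hyp2F1 A B c z)).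
{ apply PSeries_correct, CV_radius_inside; rewrite Hr; exact Hz. }
assert (H1 : is_pseries (PS_derive a) z (hyp2F1_d1 A B c z)).
{ apply PSeries_correct, CV_radius_inside.
  rewrite CV_radius_derive, Hr; exact Hz. }
assert (H2 : is_pseries (PS_derive (PS_derive a)) z (hyp2F1_d2 A B c z)).
{ apply PSeries_correct, CV_radius_inside.
  rewrite !CV_radius_derive, Hr; exact Hz. }
assert (H1z := is_pseries_incr_1 _ _ _ H1).
assert (H2z := is_pseries_incr_1 _ _ _ H2).
assert (H2zz := is_pseries_incr_1 _ _ _ H2z).
assert (Hs : forall (k : R) (b : nat -> R) l, is_pseries b z l ->
   is_pseries (PS_scal k b) z (k * l)).
{ intros k b l Hb; apply (is_pseries_scal (V := R_NormedModule));
    [apply Rmult_comm | exact Hb]. }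
assert (Hsum := is_pseries_plus _ _ _ _ _
  (is_pseries_plus _ _ _ _ _ H2z (Hs (-1) _ _ H2zz))
  (is_pseries_plus _ _ _ _ _
     (is_pseries_plus _ _ _ _ _ (Hs c _ _ H1) (Hs (- (A + B + 1)) _ _ H1z))
     (Hs (- (A * B)) _ _ H0))).
apply is_pseries_unique in Hsum.
unfold plus, scal in Hsum; simpl in Hsum; unfold mult in Hsum; simpl in Hsum.
transitivity (PSeries (fun _ => 0) z); [|apply PSeries_const_0].
etransitivity; [|etransitivity; [symmetry; exact Hsum|]]; [ring|].
apply PSeries_ext; intros n.
assert (Hrec : (c + INR n) * (INR n + 1) * a (S n)
               = (A + INR n) * (B + INR n) * a n).
{ unfold a; rewrite hyp_coef_S by exact Hc.
  generalize (pos_INR n); intros; field; lra. }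
unfold PS_plus, PS_scal, PS_incr_1, PS_derive, plus, scal, zero; cbn -[INR];
  unfold mult; cbn -[INR].
(* The two lowest orders are apart: there the shifted series start with 0. *)
destruct n as [|[|n]]; cbn -[INR]; rewrite ?S_INR in *; simpl INR in *; lra.
Qed.

Lemma hyp2F1_0 (A B c : R) : hyp2F1 A B c 0 = 1.
Proof.
unfold hyp2F1; rewrite PSeries_0; simpl; field.
Qed.

Lemma hyp2F1_ge_1 (A B c z : R) :
  0 < A -> 0 < B -> 0 < c -> 0 <= z < 1 -> 1 <= hyp2F1 A B c z.
Proof.
intros HA HB Hc Hz.
assert (Hex : ex_pseries (hyp_coef A B c) z).
{ apply CV_radius_inside; rewrite CV_radius_hyp_coef by assumption.
  simpl; rewrite Rabs_pos_eq; lra. }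
change (1 <= PSeries (hyp_coef A B c) z).
rewrite PSeries_decr_1 by exact Hex.
replace (hyp_coef A B c 0) with 1 by (unfold hyp_coef; simpl; field).
assert (0 <= PSeries (PS_decr_1 (hyp_coef A B c)) z); [|nra].
destruct (Req_dec z 0) as [->|Hz0].
{ rewrite PSeries_0; apply Rlt_le, hyp_coef_pos; assumption. }
unfold PSeries.
rewrite <- (Rmult_0_l (Series (fun _ => 0))), <- Series_scal_l.
apply Series_le.
- intros n; split; [lra|]; rewrite Rmult_0_l.
  apply Rmult_le_pos; [apply Rlt_le, hyp_coef_pos | apply pow_le]; lra.
- apply ex_pseries_R, ex_pseries_decr_1; [|exact Hex].
  right; exists (/ z); apply Rinv_l, Hz0.
Qed.

(** * Uniqueness of the regular solution at a singular point *)

Lemma zero_derivative_eq_limit (x0 b l : R) (f : R -> R) :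
  (forall x, x0 < x < b -> is_derive f x 0) ->
  filterlim f (at_right x0) (locally l) ->
  forall x, x0 < x < b -> f x = l.
Proof.
intros Hd Hl x Hx.
apply eq_sym, (filterlim_locally_unique (F := at_right x0) f); [exact Hl|].
apply filterlim_ext_loc with (fun _ => f x); [|apply filterlim_const].
assert (Hpos : 0 < x - x0) by lra.
exists (mkposreal _ Hpos); intros s Hs Hs0.
apply Rabs_lt_between' in Hs; simpl in Hs.
apply eq_sym, (eq_is_derive f); [|lra].
intros r Hr; apply Hd; lra.
Qed.

(** Nothing is asked of [P] and [Q] at [x0], where they may be singular; the
    continuity of [u] and [du] there expresses that [u] is the regular
    solution. *)
Definition solves_ode (P Q : R -> R) (x0 b : R) (u du : R -> R) : Prop :=
  continuous u x0 /\ continuous du x0 /\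
  forall x, x0 < x < b ->
    is_derive u x (du x) /\ is_derive du x (- P x * du x - Q x * u x).

(** By Abel's identity [mu * (u v' - v u')] is constant, and it tends to [0] at
    [x0] because [mu] does and the Wronskian stays bounded.  So the Wronskian
    vanishes, i.e. [v / u] has zero derivative. *)
Lemma solves_ode_unique (P Q mu : R -> R) (x0 b : R) (u du v dv : R -> R) :
  solves_ode P Q x0 b u du ->
  solves_ode P Q x0 b v dv ->
  (forall x, x0 < x < b -> is_derive mu x (P x * mu x)) ->
  (forall x, x0 < x < b -> 0 < mu x) ->
  filterlim mu (at_right x0) (locally 0) ->
  (forall x, x0 <= x < b -> u x <> 0) ->
  forall x, x0 < x < b -> v x / u x = v x0 / u x0.
Proof.
intros (Cu & Cdu & Hu) (Cv & Cdv & Hv) Hmu Hmupos Hmu0 Hnz.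
assert (Hright : forall (f : R -> R) (l : R),
          filterlim f (locally x0) (locally l) ->
          filterlim f (at_right x0) (locally l)).
{ intros f l Hf; eapply filterlim_filter_le_1; [|exact Hf].
  apply filter_le_within. }
assert (HW : forall x, x0 < x < b -> mu x * (u x * dv x - v x * du x) = 0).
{ apply zero_derivative_eq_limit.
  - intros x Hx.
    destruct (Hu x Hx) as [Hu1 Hu2], (Hv x Hx) as [Hv1 Hv2].
    specialize (Hmu x Hx).
    auto_derive.
    + repeat split; eexists; eassumption.
    + rewrite (is_derive_unique (fun x : R => u x) _ _ Hu1),
        (is_derive_unique (fun x : R => du x) _ _ Hu2),
        (is_derive_unique (fun x : R => v x) _ _ Hv1),
        (is_derive_unique (fun x : R => dv x) _ _ Hv2),
        (is_derive_unique (fun x : R => mu x) _ _ Hmu).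
      ring.
  - replace 0 with (0 * (u x0 * dv x0 - v x0 * du x0)) by ring.
    apply (filterlim_comp_2 (F := at_right x0) mu
             (fun x => u x * dv x - v x * du x) Rmult
             (G := locally 0)
             (H := locally (u x0 * dv x0 - v x0 * du x0)));
      [exact Hmu0 | apply Hright | apply (filterlim_mult (K := R_AbsRing))].
    apply (continuous_minus (V := R_NormedModule)
             (fun x => u x * dv x) (fun x => v x * du x));
      apply (continuous_mult (K := R_AbsRing)); assumption. }
assert (Hx0 : forall x, x0 < x < b -> u x0 <> 0).
{ intros x Hx; apply Hnz; lra. }
intros x Hx.
apply (zero_derivative_eq_limit x0 b (v x0 / u x0) (fun x => v x / u x));
  [| |exact Hx].
- clear x Hx; intros x Hx.
  destruct (Hu x Hx) as [Hu1 _], (Hv x Hx) as [Hv1 _].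
  assert (Hux : u x <> 0) by (apply Hnz; lra).
  replace 0 with ((dv x * u x - v x * du x) / (u x) ^ 2).
  + apply is_derive_div; assumption.
  + specialize (HW x Hx); specialize (Hmupos x Hx).
    apply Rmult_integral in HW as [HW|HW]; [lra|].
    replace (dv x * u x - v x * du x) with 0 by lra.
    field; exact Hux.
- apply Hright.
  apply (continuous_mult (K := R_AbsRing) v (fun x => / u x)); [exact Cv|].
  apply (continuous_comp u Rinv); [exact Cu|].
  apply continuous_Rinv, (Hx0 x Hx).
Qed.

(** * Pullbacks of the hypergeometric equation *)

(** Differentiating [g F(z)] twice, with [g' = L g], and eliminating [F''] by
    the hypergeometric equation leaves a combination of [F'] and [F]; the last
    two hypotheses say that the coefficient of each of them vanishes, after
    clearing the denominator [z (1 - z)].  Using the logarithmic derivative [L]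
    keeps [g], which may involve real powers, out of these identities. *)
Lemma hyp2F1_pullback_solves (A B c x0 b : R)
    (z dz ddz g L dL P Q : R -> R) :
  0 < A -> 0 < B -> 0 < c -> x0 < b ->
  (forall x, x0 <= x < b -> Rabs (z x) < 1) ->
  (forall x, x0 < x < b -> 0 < z x) ->
  (forall x, x0 <= x < b -> is_derive z x (dz x)) ->
  (forall x, x0 <= x < b -> is_derive dz x (ddz x)) ->
  (forall x, x0 <= x < b -> is_derive g x (L x * g x)) ->
  (forall x, x0 <= x < b -> is_derive L x (dL x)) ->
  (forall x, x0 < x < b ->
     z x * (1 - z x) * (ddz x + (2 * L x + P x) * dz x)
     = (c - (A + B + 1) * z x) * dz x ^ 2) ->
  (forall x, x0 < x < b ->
     z x * (1 - z x) * (dL x + L x ^ 2 + P x * L x + Q x)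
     = - (A * B * dz x ^ 2)) ->
  solves_ode P Q x0 b
    (fun x => g x * hyp2F1 A B c (z x))
    (fun x => g x * (L x * hyp2F1 A B c (z x) + dz x * hyp2F1_d1 A B c (z x))).
Proof.
intros HA HB Hc Hb Hz1 Hz0 Hdz Hddz Hg HL HP HQ.
assert (H1 : forall x, x0 <= x < b ->
  is_derive (fun x => g x * hyp2F1 A B c (z x)) x
    (g x * (L x * hyp2F1 A B c (z x) + dz x * hyp2F1_d1 A B c (z x)))).
{ intros x Hx.
  assert (Hf := is_derive_hyp2F1 A B c (z x) HA HB Hc (Hz1 x Hx)).
  specialize (Hg x Hx); specialize (Hdz x Hx).
  auto_derive.
  - repeat split; eexists; eassumption.
  - rewrite (is_derive_unique (fun x : R => g x) _ _ Hg),
      (is_derive_unique (fun x : R => z x) _ _ Hdz),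
      (is_derive_unique (fun x : R => hyp2F1 A B c x) _ _ Hf).
    ring. }
assert (H2 : forall x, x0 <= x < b ->
  is_derive (fun x => g x * (L x * hyp2F1 A B c (z x)
                             + dz x * hyp2F1_d1 A B c (z x))) x
    (g x * ((dL x + L x ^ 2) * hyp2F1 A B c (z x)
            + (2 * L x * dz x + ddz x) * hyp2F1_d1 A B c (z x)
            + dz x ^ 2 * hyp2F1_d2 A B c (z x)))).
{ intros x Hx.
  assert (Hf := is_derive_hyp2F1 A B c (z x) HA HB Hc (Hz1 x Hx)).
  assert (Hf1 := is_derive_hyp2F1_d1 A B c (z x) HA HB Hc (Hz1 x Hx)).
  specialize (Hg x Hx); specialize (Hdz x Hx);
    specialize (Hddz x Hx); specialize (HL x Hx).
  auto_derive.
  - repeat split; eexists; eassumption.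
  - rewrite (is_derive_unique (fun x : R => g x) _ _ Hg),
      (is_derive_unique (fun x : R => z x) _ _ Hdz),
      (is_derive_unique (fun x : R => dz x) _ _ Hddz),
      (is_derive_unique (fun x : R => L x) _ _ HL),
      (is_derive_unique (fun x : R => hyp2F1 A B c x) _ _ Hf),
      (is_derive_unique (fun x : R => hyp2F1_d1 A B c x) _ _ Hf1).
    ring. }
split; [|split].
- apply (ex_derive_continuous (K := R_AbsRing) (V := R_NormedModule)).
  eexists; apply H1; lra.
- apply (ex_derive_continuous (K := R_AbsRing) (V := R_NormedModule)).
  eexists; apply H2; lra.
- intros x Hx; assert (Hx' : x0 <= x < b) by lra.
  split; [now apply H1|].
  assert (Hode := hyp2F1_ode A B c (z x) HA HB Hc (Hz1 x Hx')).
  specialize (HP x Hx); specialize (HQ x Hx); specialize (Hz0 x Hx).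
  assert (Hz1' := Hz1 x Hx'); apply Rabs_lt_between in Hz1'.
  refine (eq_ind _ (fun l => is_derive _ x l) (H2 x Hx') _ _).
  set (F := hyp2F1 A B c (z x)) in *.
  set (F1 := hyp2F1_d1 A B c (z x)) in *.
  set (F2 := hyp2F1_d2 A B c (z x)) in *.
  (* The difference of the two sides is a combination of the three equations
     [HQ], [HP] and [Hode]. *)
  apply Rmult_eq_reg_l with (z x * (1 - z x)); [|nra].
  apply Rminus_diag_uniq.
  transitivity
    (g x * (F * (z x * (1 - z x) * (dL x + L x ^ 2 + P x * L x + Q x)
             + A * B * dz x ^ 2)
      + F1 * (z x * (1 - z x) * (ddz x + (2 * L x + P x) * dz x)
              - (c - (A + B + 1) * z x) * dz x ^ 2)
      + dz x ^ 2 * (z x * (1 - z x) * F2 + (c - (A + B + 1) * z x) * F1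
                    - A * B * F)));
    [ring|].
  rewrite HP, HQ, Hode; ring.
Qed.

(** * The two sides as solutions of one equation in t *)

(** With [z] the left-hand argument and [A], [B], [c] the left-hand parameters,
    this is [(c - (A+B+1) z) z' / (z (1 - z)) - z'' / z'] in partial
    fractions. *)
Definition ode_P (a t : R) : R :=
  (3 - 3 * a) / t + 2 * (3 - 3 * a) / (2 * t + 3) + 5 / 3 / (t + 1)
  + (3 * a - 7 / 3) / (t + 2) - 1 / (t + 3).

(** In the same notation, this is [- A B z'^2 / (z (1 - z))]. *)
Definition ode_Q (a t : R) : R :=
  2 * (4 / 3 - a) * (2 - 2 * a) * (t + 3) ^ 2 / (t * (2 * t + 3) * (t + 2) ^ 2).

(** Up to a constant, the weight [z^c (1 - z)^(A+B+1-c) / z'].  The factor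
    [(2t+3)^(3-3a)], which alone is singular at [t = -3/2], is kept apart: it
    carries the limit [0] there. *)
Definition integrating_factor (a t : R) : R :=
  exp ((3 - 3 * a) * ln (2 * t + 3))
  * exp ((3 - 3 * a) * ln (- t) + 5 / 3 * ln (- 1 - t)
         + (3 * a - 7 / 3) * ln (t + 2) - ln (t + 3)).

Definition lhs_argument (t : R) : R := - (t * (2 * t + 3) / (t + 2)).

Definition rhs_argument (t : R) : R := - ((2 * t + 3) ^ 3 / (t ^ 3 * (t + 2))).

Definition prefactor (a t : R) : R :=
  Rpower 2 (2 * a - 2) * Rpower 3 (5 / 2 - 3 * a) * Rpower (- t) (3 * a - 9 / 2)
  * Rpower (t + 2) (1 / 2 - a) * (t + 3) ^ 2.

Lemma is_derive_integrating_factor (a t : R) :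
  -3/2 < t < -1 ->
  is_derive (integrating_factor a) t (ode_P a t * integrating_factor a t).
Proof.
intros Ht; unfold integrating_factor.
auto_derive.
- repeat split; lra.
- unfold ode_P, Rminus; field; repeat split; lra.
Qed.

Lemma integrating_factor_lim (a : R) :
  a < 1 ->
  filterlim (integrating_factor a) (at_right (-3/2)) (locally 0).
Proof.
intros Ha; unfold integrating_factor.
set (h := fun t : R => exp ((3 - 3 * a) * ln (- t) + 5 / 3 * ln (- 1 - t)
         + (3 * a - 7 / 3) * ln (t + 2) - ln (t + 3))).
replace 0 with (0 * h (-3/2)) by ring.
eapply (filterlim_comp_2 (F := at_right (-3/2)) _ h);
  [ | | apply (filterlim_mult (K := R_AbsRing))].
- apply (filterlim_comp _ _ _ (fun t => (3 - 3 * a) * ln (2 * t + 3)) exp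
           _ (Rbar_locally m_infty)); [|apply is_lim_exp_m].
  apply (filterlim_comp _ _ _ (fun t => ln (2 * t + 3)) (Rmult (3 - 3 * a))
           _ (Rbar_locally m_infty)).
  + apply (filterlim_comp _ _ _ (fun t => 2 * t + 3) ln _ (at_right 0));
      [|apply is_lim_ln_0].
    intros S [e He].
    assert (He2 : 0 < e / 2) by (generalize (cond_pos e); lra).
    exists (mkposreal _ He2); intros t Ht Ht0.
    apply Rabs_lt_between' in Ht; simpl in Ht.
    apply He; [apply Rabs_lt_between'; simpl|]; lra.
  + assert (Hm : Rbar_mult (3 - 3 * a) m_infty = m_infty).
    { apply is_Rbar_mult_unique, is_Rbar_mult_sym, is_Rbar_mult_m_infty_pos.
      simpl; lra. }
    rewrite <- Hm at 2; apply filterlim_Rbar_mult_l.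
- eapply filterlim_filter_le_1; [apply filter_le_within|].
  apply (ex_derive_continuous (K := R_AbsRing) (V := R_NormedModule) h).
  unfold h; auto_derive; repeat split; lra.
Qed.

Lemma lhs_argument_left : lhs_argument (-3/2) = 0.
Proof. unfold lhs_argument; field. Qed.

Lemma lhs_argument_range (t : R) :
  -3/2 <= t < -1 -> 0 <= lhs_argument t < 1.
Proof.
intros Ht; destruct (Req_dec t (-3/2)) as [->|Hne].
- rewrite lhs_argument_left; lra.
- assert (Hb : -3/2 < t < -1) by lra.
  apply lhs_argument_bounds in Hb; unfold lhs_argument; lra.
Qed.

Lemma rhs_argument_left : rhs_argument (-3/2) = 0.
Proof. unfold rhs_argument; field. Qed.

Lemma rhs_argument_range (t : R) :
  -3/2 <= t < -1 -> 0 <= rhs_argument t < 1.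
Proof.
intros Ht; destruct (Req_dec t (-3/2)) as [->|Hne].
- rewrite rhs_argument_left; lra.
- assert (Hb : -3/2 < t < -1) by lra.
  apply rhs_argument_bounds in Hb; unfold rhs_argument; lra.
Qed.

(** The numerical constants in the prefactor are those that make this hold. *)
Lemma prefactor_left (a : R) : prefactor a (-3/2) = 1.
Proof.
unfold prefactor.
replace (- (-3 / 2)) with (3 * / 2) by field.
replace (-3 / 2 + 2) with (/ 2) by field.
replace ((-3 / 2 + 3) ^ 2) with (Rpower (3 * / 2) (INR 2))
  by (rewrite Rpower_pow by lra; field).
unfold Rpower.
rewrite ln_mult, ln_Rinv by lra.
rewrite <- !exp_plus.
transitivity (exp 0); [f_equal; simpl INR; field | apply exp_0].
Qed.

(** The factor [1] plays the part of [g] in [hyp2F1_pullback_solves]. *)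
Lemma lhs_solves (a : R) :
  a < 1 ->
  exists du, solves_ode (ode_P a) (ode_Q a) (-3/2) (-1)
    (fun t => 1 * hyp2F1 (4/3 - a) (2 - 2 * a) (3 - 3 * a) (lhs_argument t)) du.
Proof.
intros Ha; eexists.
apply (hyp2F1_pullback_solves _ _ _ _ _ lhs_argument
  (fun t => - (2 * (t + 1) * (t + 3) / (t + 2) ^ 2))
  (fun t => - (4 / (t + 2) ^ 3)) (fun _ => 1) (fun _ => 0) (fun _ => 0));
  try lra.
- intros t Ht; apply lhs_argument_range in Ht.
  rewrite Rabs_pos_eq; lra.
- intros t Ht; apply (lhs_argument_bounds t Ht).
- intros t Ht; unfold lhs_argument; auto_derive; [lra | field; lra].
- intros t Ht; auto_derive; [nra | field; lra].
- intros t Ht; auto_derive; [trivial | ring].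
- intros t Ht; auto_derive; [trivial | ring].
- intros t Ht; unfold ode_P, lhs_argument; field; repeat split; lra.
- intros t Ht; unfold ode_Q, lhs_argument; field; repeat split; lra.
Qed.

Lemma rhs_solves (a : R) :
  a < 1 ->
  exists dv, solves_ode (ode_P a) (ode_Q a) (-3/2) (-1)
    (fun t => prefactor a t
              * hyp2F1 (5/6) (3/2 - a) (5/3 - a) (rhs_argument t)) dv.
Proof.
intros Ha; eexists.
apply (hyp2F1_pullback_solves _ _ _ _ _ rhs_argument
  (fun t => 2 * (2 * t + 3) ^ 2 * (t + 3) ^ 2 / (t ^ 4 * (t + 2) ^ 2))
  (fun t => 2 * (2 * t + 3) * (t + 3) / (t ^ 4 * (t + 2) ^ 2)
            * (4 * (t + 3) + 2 * (2 * t + 3)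
               - (2 * t + 3) * (t + 3) * (4 / t + 2 / (t + 2))))
  (prefactor a)
  (fun t => (3 * a - 9 / 2) / t + (1 / 2 - a) / (t + 2) + 2 / (t + 3))
  (fun t => - ((3 * a - 9 / 2) / t ^ 2 + (1 / 2 - a) / (t + 2) ^ 2
               + 2 / (t + 3) ^ 2)));
  try lra.
- intros t Ht; apply rhs_argument_range in Ht.
  rewrite Rabs_pos_eq; lra.
- intros t Ht; apply (rhs_argument_bounds t Ht).
(* [y' = y (6/(2t+3) - 3/t - 1/(t+2))], where the bracket simplifies to
   [-2 (t+3)^2 / (t (t+2) (2t+3))]. *)
- intros t Ht; unfold rhs_argument; auto_derive.
  + repeat apply Rmult_integral_contrapositive_currified; lra.
  + field; lra.
- intros t Ht; auto_derive.
  + repeat apply Rmult_integral_contrapositive_currified; lra.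
  + field; lra.
- intros t Ht; unfold prefactor, Rpower; auto_derive.
  + repeat split; lra.
  + field; repeat split; lra.
- intros t Ht; auto_derive; [repeat split; lra | field; repeat split; lra].
- intros t Ht; unfold ode_P, rhs_argument; field; repeat split; lra.
- intros t Ht; unfold ode_P, ode_Q, rhs_argument; field; repeat split; lra.
Qed.

Theorem corollary9p2 (t a : R) (ht1 : -3/2 < t) (ht2 : t < -1) (ha : a < 5/6) :
  hyp2F1 (4/3 - a) (2 - 2*a) (3 - 3*a) (- (t * (2*t + 3) / (t + 2)))
  = (Rpower 2 (2*a - 2) * Rpower 3 (5/2 - 3*a) * Rpower (- t) (3*a - 9/2)
     * Rpower (t + 2) (1/2 - a) * (t + 3) ^ 2)
    * hyp2F1 (5/6) (3/2 - a) (5/3 - a)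
        (- ((2*t + 3) ^ 3 / (t ^ 3 * (t + 2)))).
Proof.
assert (ha1 : a < 1) by lra.
destruct (lhs_solves a ha1) as [du Hu], (rhs_solves a ha1) as [dv Hv].
assert (Hpos : forall x, -3/2 <= x < -1 ->
  0 < hyp2F1 (4/3 - a) (2 - 2*a) (3 - 3*a) (lhs_argument x)).
{ intros x Hx; apply Rlt_le_trans with 1; [lra|].
  apply hyp2F1_ge_1; try lra.
  exact (lhs_argument_range x Hx). }
assert (Ht : -3/2 < t < -1) by lra.
assert (Heq := solves_ode_unique _ _ (integrating_factor a) _ _ _ _ _ _ Hu Hv
  (is_derive_integrating_factor a)
  (fun x _ => Rmult_lt_0_compat _ _ (exp_pos _) (exp_pos _))
  (integrating_factor_lim a ha1)
  (fun x Hx => Rgt_not_eq _ _ (Rmult_lt_0_compat _ _ Rlt_0_1 (Hpos x Hx))) t Ht).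
cbv beta in Heq.
rewrite lhs_argument_left, rhs_argument_left, prefactor_left, !hyp2F1_0 in Heq.
specialize (Hpos t ltac:(lra)).
fold (lhs_argument t) (rhs_argument t) (prefactor a t).
apply Rmult_eq_reg_r with
  (/ hyp2F1 (4/3 - a) (2 - 2*a) (3 - 3*a) (lhs_argument t));
  [|apply Rinv_neq_0_compat; lra].
rewrite Rinv_r by lra; symmetry.
etransitivity; [|etransitivity; [exact Heq|field]].
field; lra.
Qed.
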